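(* Let $V$ be a finite set of sites and let $\mathcal{A}$ be a finite collection of nonempty subsets of $V$. For $S=(S_i)_{i\in V}\in\{-1,1\}^V$ and $A\in\mathcal{A}$ put $S_A=\prod_{i\in A}S_i$. Let $(J_A)_{A\in\mathcal{A}}$ be independent standard Gaussian random variables, and for $x=(x_A)_{A\in\mathcal{A}}\in[0,\infty)^{\mathcal{A}}$ define $$P(x)=\mathbb{E}\left[\log \sum_{S\in\{-1,1\}^V}\exp\Big(\sum_{A\in\mathcal{A}}\big(\sqrt{x_A}\,J_A+x_A\big)S_A\Big)\right],$$ where $\mathbb{E}$ denotes expectation over $(J_A)$. Then $P$ is a convex function of $x$ on $[0,\infty)^{\mathcal{A}}$.
   Context: Equivalently, $P(x)=\mathbb{E}[\log Z]$ for the Ising spin-glass model $Z=\sum_{S}\exp(\sum_{A}\beta_A J'_A S_A)$ on the Nishimori line, where $J'_A$ are independent Gaussians with mean $J_{A0}$ and variance $\sigma_A^2>0$, and the Nishimori condition $\beta_A=J_{A0}/\sigma_A^2$ holds; the parametrization is $\beta_A=\sqrt{x_A}/\sigma_A$, $J_{A0}=\sigma_A\sqrt{x_A}$. *)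

(* Defs.v *)
From HB Require Import structures.
From mathcomp Require Import all_boot all_order all_algebra.
From mathcomp Require Import all_classical all_reals all_analysis.
Set Implicit Arguments. Unset Strict Implicit. Unset Printing Implicit Defensive.
Import Order.TTheory GRing.Theory Num.Theory.
Local Open Scope classical_set_scope.
Local Open Scope ring_scope.

Section defs.
Context {R : realType} {V : finType}.

Definition spin (S : {ffun V -> bool}) (i : V) : R := if S i then 1 else -1.

Definition spinA (S : {ffun V -> bool}) (A : {set V}) : R :=
  \prod_(i in A) spin S i.

Definition partition_fun (Acal : {set {set V}}) (x j : {set V} -> R) : R :=
  \sum_(S : {ffun V -> bool})
     expR (\sum_(A in Acal) (Num.sqrt (x A) * j A + x A) * spinA S A).

(* Mutual independence of the finite family (J_A)_{A in Acal}:
   the joint law of preimages of measurable sets factorizes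
   (sub-families are obtained by choosing B A = setT). *)
Definition mutually_independent d (T : measurableType d)
  (P : probability T R) (Acal : {set {set V}}) (J : {set V} -> T -> R) : Prop :=
  forall B : {set V} -> set R,
    (forall A, A \in Acal -> measurable (B A)) ->
    P (\bigcap_(A in [set A | A \in Acal]) (J A @^-1` B A)) =
    (\prod_(A in Acal) P (J A @^-1` B A))%E.

Definition standard_gaussian d (T : measurableType d)
  (P : probability T R) (X : {RV P >-> R}) : Prop :=
  forall B : set R, measurable B -> distribution P X B = normal_prob 0 1 B.

Definition free_energy d (T : measurableType d)
  (P : probability T R) (Acal : {set {set V}}) (J : {set V} -> T -> R)
  (x : {set V} -> R) : \bar R :=
  'E_P[fun w => ln (partition_fun Acal x (fun A => J A w))].

End defs.

(* Main.v *)
Require Import Defs.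
From HB Require Import structures.
From mathcomp Require Import all_boot all_order all_algebra.
From mathcomp Require Import all_classical all_reals all_analysis.
From mathcomp Require Import measurable_realfun.
From mathcomp Require Import ring lra.

(* Write Z(y) = sum_S exp(sum_A y_A S_A). Flipping signs along a spin
   configuration leaves Z invariant, so the Cameron-Martin formula, averaged
   over S, gives
     P(x) = 2^(-|V|) exp(-|x|/2) E [(Z log Z)(sqrt(x) J)],   |x| = sum_A x_A,
   where the drift has disappeared. Gaussian integration by parts shows that
   exp(-|x|/2) E [G(sqrt(x) J)] has x_A-derivative
     exp(-|x|/2) E [((d_A^2 G - G)/2)(sqrt(x) J)].
   As d_A^2 Z = Z, applying (d_A^2 - 1) and then (d_B^2 - 1) to Z log Z gives
   2 Z c_AB^2, where c_AB is the Gibbs covariance of S_A and S_B. The Hessian of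
   P is thus an average of Hadamard squares of covariance matrices, which are
   positive semidefinite. *)

Import Order.TTheory GRing.Theory Num.Theory.
Import numFieldNormedType.Exports.
Set Implicit Arguments.
Unset Strict Implicit.
Unset Printing Implicit Defensive.
Local Open Scope classical_set_scope.
Local Open Scope ring_scope.

(** * One-dimensional Gaussian shift and reflection *)

Section gaussian_shift.
Context {R : realType}.
Local Notation mu := (@lebesgue_measure R).

(** The drift [x_A] is the square of the coefficient [sqrt(x_A)] of the Gaussian, which is the
    Nishimori condition. For this reason flipping the whole argument along a configuration is a
    Cameron-Martin shift of the flipped Gaussian, and the densities of all configurations add up to
    [Z] itself. With the drift gone, [x] enters only through variances. The obstacle is that the
    square root is not differentiable at 0. Convexity is therefore tested on a segment: in its
    interior each coordinate is either constant or positive, and the endpoints are reached by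
    continuity. Integration by parts also cancels the factor [1/sqrt(x_A)] created by the chain
    rule. Limits and derivatives under the expectation rest on one growth class, bounded by the
    exponential of a multiple of 1 + sum |y_A|, which is integrable and stable under the algebra
    used. *)

Lemma ge0_integral_normal_prob (m s : R) (f : R -> \bar R) :
  measurable_fun [set: R] f -> (forall x, 0 <= f x)%E ->
  (\int[normal_prob m s]_x f x = \int[mu]_x (f x * (normal_pdf m s x)%:E))%E.
Proof.
move=> mf f0.
have dom := normal_prob_dominates m s.
rewrite -(Radon_Nikodym_SigmaFinite.change_of_variables dom)//.
have intRN := Radon_Nikodym_SigmaFinite.f_integrable dom.
have mpdf : measurable_fun [set: R] (fun x => (normal_pdf m s x)%:E).
  by apply/measurable_EFinP; exact: measurable_normal_pdf.
apply: ge0_ae_eq_integral => //.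
- by apply: emeasurable_funM => //; exact: measurable_int intRN.
- exact: emeasurable_funM.
- by move=> x _; rewrite mule_ge0// Radon_Nikodym_SigmaFinite.f_ge0.
- by move=> x _; rewrite mule_ge0// lee_fin normal_pdf_ge0.
move=> *; apply: ae_eqe_mul2l.
(* The Radon-Nikodym derivative and [normal_pdf] have equal integrals over every measurable set,
   hence agree almost everywhere. *)
apply: integral_ae_eq => // E _ mE.
by rewrite -Radon_Nikodym_SigmaFinite.f_integral.
Qed.

Lemma ge0_integral_lebesgueN (f : R -> \bar R) :
  measurable_fun [set: R] f -> (forall x, 0 <= f x)%E ->
  (\int[mu]_x f (- x)%R = \int[mu]_x f x)%E.
Proof.
move=> mf f0.
transitivity (\int[pushforward mu (-%R : _ -> measurableTypeR R)]_x f x)%E.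
  by rewrite ge0_integral_pushforward.
by apply: eq_measure_integral => A mA _; exact: lebesgue_measureN.
Qed.

Lemma lebesgue_measureD (s : R) (A : set R) : measurable A ->
  pushforward mu ((fun x : R => x + s) : _ -> measurableTypeR R) A = mu A.
Proof.
have ms : measurable_fun [set: R] (fun x : R => x + s).
  exact: measurable_funD.
move=> mA; apply/esym.
apply: (@lebesgue_measure_unique _ (pushforward mu _)) => //= _ [[a b]] _ <-.
rewrite /pushforward/= [X in lebesgue_measure X = _](_ : _ = `]a, b]%classic)//.
rewrite [X in _ = lebesgue_measure X](_ : _ = `]a - s, b - s]%classic).
  rewrite !lebesgue_measure_itv/= !lte_fin ltrD2r.
  by case: ifPn => // ab; rewrite -!EFinB; congr EFin; ring.
by apply/seteqP; split => x /=; rewrite !in_itv/= ltrBlDr lerBrDr.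
Qed.

Lemma ge0_integral_lebesgueD (s : R) (f : R -> \bar R) :
  measurable_fun [set: R] f -> (forall x, 0 <= f x)%E ->
  (\int[mu]_x f (x + s)%R = \int[mu]_x f x)%E.
Proof.
move=> mf f0.
have ms : measurable_fun [set: R] (fun x : R => x + s).
  exact: measurable_funD.
transitivity (\int[pushforward mu
    ((fun x : R => (x + s)%R) : _ -> measurableTypeR R)]_x f x)%E.
  by rewrite ge0_integral_pushforward.
by apply: eq_measure_integral => A mA _; exact: lebesgue_measureD.
Qed.

Lemma normal_pdf01 (x : R) :
  normal_pdf 0 1 x = normal_peak 1 * expR (- (x ^+ 2 / 2)).
Proof.
by rewrite normal_pdfE ?oner_eq0// /normal_fun subr0 expr1n mulNr.
Qed.

(** The reflection costs nothing because the density is even; the translation is paid for by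
    completing the square. The sign [b] is carried along for the spin flips. *)
Lemma ge0_gaussian_shift (b : bool) (s : R) (g : R -> \bar R) :
  measurable_fun [set: R] g -> (forall x, 0 <= g x)%E ->
  (\int[normal_prob 0 1]_x g ((-1) ^+ b * x + s)%R
   = \int[normal_prob 0 1]_x (g x * (expR (s * x - s ^+ 2 / 2))%:E))%E.
Proof.
move=> mg g0.
have mpdf : measurable_fun [set: R] (fun x => (normal_pdf 0 1 x)%:E).
  by apply/measurable_EFinP; exact: measurable_normal_pdf.
have me : measurable_fun [set: R] (fun x => (expR (s * x - s ^+ 2 / 2))%:E).
  apply/measurable_EFinP; apply: measurableT_comp => //.
  by apply: measurable_funB => //; exact: measurable_funM.
have ms : measurable_fun [set: R] (fun x => (-1) ^+ b * x + s).
  by apply: measurable_funD => //; exact: measurable_funM.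
have mgs : measurable_fun [set: R] (fun x => g ((-1) ^+ b * x + s)%R).
  exact: measurableT_comp.
rewrite ge0_integral_normal_prob// ge0_integral_normal_prob//; last 2 first.
- exact: emeasurable_funM.
- by move=> x; rewrite mule_ge0// lee_fin expR_ge0.
transitivity (\int[mu]_x (g (x + s)%R * (normal_pdf 0 1 x)%:E))%E.
  case: b {ms mgs}; last by apply: eq_integral => x _; rewrite expr0 mul1r.
  rewrite -[RHS]ge0_integral_lebesgueN; first last.
  - by move=> x; rewrite mule_ge0// lee_fin normal_pdf_ge0.
  - apply: emeasurable_funM => //; apply: measurableT_comp => //.
    exact: measurable_funD.
  by apply: eq_integral => x _; rewrite expr1 mulN1r !normal_pdf01 sqrrN.
rewrite -[RHS](ge0_integral_lebesgueD s); first last.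
- by move=> x; rewrite !mule_ge0// lee_fin ?normal_pdf_ge0 ?expR_ge0.
- by do 2 apply: emeasurable_funM => //.
apply: eq_integral => x _; rewrite -muleA; congr (_ * _)%E.
rewrite !normal_pdf01 -EFinM; congr EFin.
rewrite mulrCA -expRD; congr (_ * expR _). by field.
Qed.

End gaussian_shift.

(** * Independence and conditioning on all variables but one *)

Section independent_gaussians.
Context {R : realType} {I : finType} (D : {set I}) {d : measure_display}
  {T : measurableType d} (P : probability T R) (J : I -> {RV P >-> R}).

Definition upd (y : I -> R) (a : I) (z : R) : I -> R :=
  fun i => if i == a then z else y i.

Lemma upd_id (y : I -> R) (a : I) : upd y a (y a) = y.
Proof. by apply/funext => i; rewrite /upd; case: eqP => [->|]. Qed.

(* Measurability in the coordinates of [D], phrased by composition with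
   arbitrary measurable families, so that [I -> R] needs no sigma-algebra. *)
Definition cylinder_measurable (G : (I -> R) -> R) :=
  forall (d' : measure_display) (U : measurableType d') (j : I -> U -> R),
    (forall i, i \in D -> measurable_fun setT (j i)) ->
    measurable_fun setT (fun u => G (fun i => j i u)).

Definition iid_gaussians : Prop :=
  (forall B : I -> set R, (forall i, i \in D -> measurable (B i)) ->
     P (\bigcap_(i in [set i | i \in D]) (J i @^-1` B i)) =
     (\prod_(i in D) P (J i @^-1` B i))%E) /\
  (forall i, i \in D ->
     forall B : set R, measurable B -> P (J i @^-1` B) = normal_prob 0 1 B).

Context (iid : iid_gaussians).

(** A pi-system generating the sigma-algebra of the [J i] with [i] in [D] other than [a]. *)
Definition cylinders (a : I) : set (set T) :=
  [set X | exists2 B : I -> set R, (forall i, measurable (B i)) &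
     X = \bigcap_(i in [set i | i \in D /\ i != a]) (J i @^-1` B i)].

Lemma cylinders_measurable (a : I) : cylinders a `<=` measurable.
Proof.
move=> _ [B mB ->]; apply: fin_bigcap_measurable => [|i _].
  exact: finite_finset.
exact: measurable_funPTI.
Qed.

Lemma cylinders_setI (a : I) : setI_closed (cylinders a).
Proof.
move=> _ _ [B mB ->] [B' mB' ->]; exists (fun i => B i `&` B' i) => [i|].
  exact: measurableI.
by rewrite -bigcapI; apply: eq_bigcapr => i _; rewrite preimage_setI.
Qed.

Lemma cylinders_setT (a : I) : cylinders a setT.
Proof.
by exists (fun=> setT) => //; apply/seteqP; split.
Qed.

Let measurable_J (i : I) (B : set R) : measurable B -> measurable (J i @^-1` B).
Proof. exact: measurable_funPTI. Qed.

(** For fixed [C] both sides are finite measures in [X]; they agree on the pi-system [cylinders a],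
    hence on the sigma-algebra it generates. *)
Lemma indep_cylinder (a : I) (C : set R) (X : set T) : a \in D ->
  measurable C -> <<s cylinders a >> X ->
  P (X `&` J a @^-1` C) = (P X * P (J a @^-1` C))%E.
Proof.
move=> aD mC sX.
have mJC := measurable_J a mC.
pose r : {nonneg R} := NngNum (fine_ge0 (measure_ge0 P (J a @^-1` C))).
have rE : (r%:num)%:E = P (J a @^-1` C) by rewrite fineK// fin_num_measure.
have key (B : I -> set R) (C' : set R) : (forall i, measurable (B i)) ->
    measurable C' ->
    P (\bigcap_(i in [set i | i \in D /\ i != a]) (J i @^-1` B i)
       `&` J a @^-1` C')
    = (P (J a @^-1` C') * \prod_(i in D | i != a) P (J i @^-1` B i))%E.
  move=> mB mC'.
  have := iid.1 (fun i => if i == a then C' else B i).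
  rewrite (bigD1 a aD)/= eqxx.
  under [X in (_ * X)%E]eq_bigr => i /andP[_ /negbTE ->] do [].
  move=> <-; last by move=> i _; case: ifP.
  congr (P _); apply/seteqP; split => [w [Xw Cw] i /= iD|w Xw].
    by case: eqVneq => [->//|ia]; apply: Xw.
  split; first by move=> i [iD ia]; have := Xw i iD; rewrite /= (negbTE ia).
  by have := Xw a aD; rewrite /= eqxx.
suff : mrestr P mJC X = mscale r P X.
  by rewrite /mrestr /mscale rE muleC.
apply: (@g_sigma_algebra_measure_unique _ _ _ (cylinders a) _
  (fun=> setT)) => //.
- exact: cylinders_measurable.
- by move=> _; exact: cylinders_setT.
- by rewrite bigcup_const.
- exact: cylinders_setI.
- move=> _ [B mB ->]; rewrite [LHS]key//.
  (* With [setT] in slot [a], [key] evaluates the probability of the cylinder alone. *)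
  have := key B setT mB measurableT.
  rewrite preimage_setT setIT probability_setT mul1e => <-.
  by rewrite -rE.
- by move=> _; rewrite /mrestr/= (le_lt_trans (probability_le1 _ _)) ?ltry//;
    apply: measurableI.
Qed.

(* [T] with the sigma-algebra generated by the variables other than [J a] plays
   the role of the second factor: the law of [w |-> (J a w, w)] is a product. *)
Lemma indep_fubini (a : I)
    (f : measurableTypeR R * g_sigma_algebraType (cylinders a) -> \bar R) :
  a \in D -> measurable_fun setT f -> (forall x, 0 <= f x)%E ->
  (\int[P]_w f (J a w, w) = \int[P]_w \int[normal_prob 0 1]_z f (z, w))%E.
Proof.
move=> aD mf f0.
pose U := g_sigma_algebraType (cylinders a).
have mid : measurable_fun setT (id : T -> U).
  apply: (@measurability _ _ T U setT id (cylinders a)) => // _ [X cX <-].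
  by rewrite setTI; exact: (cylinders_measurable cX).
have mpair : measurable_fun setT (fun w => (J a w : measurableTypeR R, w : U)).
  by apply: measurable_fun_pair; [exact: (measurable_funP (J a))|exact: mid].
pose idm := mfun_Sub (mem_set mid).
pose PU := distribution P idm.
transitivity (\int[pushforward P
    (fun w => (J a w : measurableTypeR R, w : U))]_x f x)%E.
  by rewrite ge0_integral_pushforward.
transitivity (\int[(normal_prob 0 1 : probability _ R) \x PU]_x f x)%E.
  apply: eq_measure_integral => A mA _; apply/esym.
  apply: product_measure_unique => // C X mC mX.
  rewrite /pushforward/= [X in P X = _](_ : _ = X `&` J a @^-1` C).
    by rewrite indep_cylinder// (iid.2 a aD)// muleC.
  by apply/seteqP; split => w [].
rewrite fubini_tonelli2//.
rewrite ge0_integral_pushforward//.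
  exact: measurable_fun_fubini_tonelli_G.
by move=> x _; apply: integral_ge0.
Qed.

Lemma cylinder_measurable_section (a : I) (G : (I -> R) -> R) :
  a \in D -> cylinder_measurable G ->
  measurable_fun setT
    (fun zw : measurableTypeR R * g_sigma_algebraType (cylinders a) =>
      G (upd (fun i => J i zw.2) a zw.1)).
Proof.
move=> aD mG; apply: (mG _
  (measurableTypeR R * g_sigma_algebraType (cylinders a))%type
  (fun i zw => if i == a then zw.1 else J i zw.2)).
move=> i iD; case: eqVneq => [_|ia]; first exact: measurable_fst.
have mJ : measurable_fun [set: g_sigma_algebraType (cylinders a)] (J i).
  move=> _ B mB; rewrite setTI; apply: sub_sigma_algebra.
  (* The preimage of [B] under [J i] is itself a cylinder, with [B] in slot [i] only. *)
  exists (fun k => if k == i then B else setT) => [k|]; first by case: ifP.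
  apply/seteqP; split => [w Bw k _ /=|w /(_ i)]; last by rewrite /= eqxx; apply.
  by case: eqVneq => // ->.
exact: (measurableT_comp mJ measurable_snd).
Qed.

(** Fubini freezes the other variables, the one-dimensional shift acts on [J a], and Fubini is
    undone. *)
Lemma gaussian_shift1 (a : I) (b : bool) (s : R) (G : (I -> R) -> R) :
  a \in D -> cylinder_measurable G -> (forall y, 0 <= G y) ->
  (\int[P]_w (G (upd (fun i => J i w) a ((-1) ^+ b * J a w + s)))%:E =
   \int[P]_w (G (fun i => J i w) * expR (s * J a w - s ^+ 2 / 2))%:E)%E.
Proof.
move=> aD mG G0.
have mE : measurable_fun setT (fun z : R => expR (s * z - s ^+ 2 / 2)).
  apply: measurableT_comp => //.
  by apply: measurable_funB => //; exact: measurable_funM.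
have mS : measurable_fun setT (fun z : R => (-1) ^+ b * z + s).
  by apply: measurable_funD => //; exact: measurable_funM.
have mGa := cylinder_measurable_section aD mG.
transitivity (\int[P]_w \int[normal_prob 0 1]_z
    (G (upd (fun i => J i w) a ((-1) ^+ b * z + s)))%:E)%E.
  pose f := fun zw : measurableTypeR R * g_sigma_algebraType (cylinders a) =>
    (G (upd (fun i => J i zw.2) a ((-1) ^+ b * zw.1 + s)))%:E.
  apply: (@indep_fubini a f) => // [|zw]; last by rewrite lee_fin.
  apply/measurable_EFinP.
  pose h := fun zw : measurableTypeR R * g_sigma_algebraType (cylinders a) =>
     ((-1) ^+ b * zw.1 + s, zw.2).
  apply: (measurableT_comp mGa (g := h)).
  apply: measurable_fun_pair => //.
  by apply: (measurableT_comp mS); exact: measurable_fst.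
transitivity (\int[P]_w \int[normal_prob 0 1]_z
    (G (upd (fun i => J i w) a z) * expR (s * z - s ^+ 2 / 2))%:E)%E.
  apply: eq_integral => w _.
  rewrite (ge0_gaussian_shift b s
    (g := fun z => (G (upd (fun i => J i w) a z))%:E)).
  - by apply: eq_integral => z _; rewrite EFinM.
  - apply/measurable_EFinP.
    apply: (mG _ (measurableTypeR R)
      (fun i z => if i == a then z else J i w)) => i _.
    by case: (i == a).
  - by move=> z; exact: G0.
pose f := fun zw : measurableTypeR R * g_sigma_algebraType (cylinders a) =>
  (G (upd (fun i => J i zw.2) a zw.1) * expR (s * zw.1 - s ^+ 2 / 2))%:E.
transitivity (\int[P]_w f (J a w, w))%E; last first.
  by apply: eq_integral => w _; rewrite /f/= upd_id.
apply/esym; apply: (@indep_fubini a f) => // [|zw]; last first.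
  by rewrite lee_fin mulr_ge0// expR_ge0.
apply/measurable_EFinP; apply: measurable_funM => //.
exact: (measurableT_comp mE measurable_fst).
Qed.

End independent_gaussians.

(** * Cameron-Martin shift in several coordinates *)

Section shift.
Context {R : realType} {I : finType} {D : {set I}} {d : measure_display}
  {T : measurableType d} {P : probability T R} {J : I -> {RV P >-> R}}
  (iid : iid_gaussians D J).

Let shift (b : I -> bool) (s : I -> R) (l : seq I) (y : I -> R) : I -> R :=
  fun i => if i \in l then (-1) ^+ b i * y i + s i else y i.

Let cylinder_measurable_shift b s l G : cylinder_measurable D G ->
  cylinder_measurable D (fun y => G (shift b s l y)).
Proof.
move=> mG d' U j mj.
apply: (mG _ _ (fun i u => shift b s l (j ^~ u) i)) => i iD.
rewrite /shift; case: (i \in l); last exact: mj.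
by apply: measurable_funD => //; apply: measurable_funM => //; exact: mj.
Qed.

Let ge0_gaussian_shift_seq b s l G : uniq l -> {subset l <= D} ->
  cylinder_measurable D G -> (forall y, 0 <= G y) ->
  (\int[P]_w (G (shift b s l (fun i => J i w)))%:E =
   \int[P]_w (G (fun i => J i w)
              * expR (\sum_(i <- l) (s i * J i w - s i ^+ 2 / 2)))%:E)%E.
Proof.
elim: l G => [|a l IH] G /=.
  move=> _ _ _ _; apply: eq_integral => w _.
  by rewrite big_nil expR0 mulr1.
move=> /andP[al ul] lD mG G0.
have aD : a \in D by apply: lD; rewrite inE eqxx.
transitivity (\int[P]_w (G (shift b s l (upd (fun i => J i w) a
    ((-1) ^+ b a * J a w + s a))))%:E)%E.
  apply: eq_integral => w _; congr (G _)%:E; apply/funext => i.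
  rewrite /shift /upd inE; case: eqVneq => [->|//].
  by rewrite (negbTE al).
rewrite (gaussian_shift1 iid (b a) (s a) aD
  (cylinder_measurable_shift b s l mG))//.
(* [G'] absorbs the density of coordinate [a]. As [a] does not occur in [l], shifting along [l]
   leaves that density unchanged, so the induction hypothesis applies to [G']. *)
pose G' y := G y * expR (s a * y a - s a ^+ 2 / 2).
transitivity (\int[P]_w (G' (shift b s l (fun i => J i w)))%:E)%E.
  by apply: eq_integral => w _; rewrite /G' {3}/shift (negbTE al).
rewrite (IH G')//.
- apply: eq_integral => w _; rewrite big_cons expRD.
  by rewrite mulrA.
- by move=> i il; apply: lD; rewrite inE il orbT.
- move=> d' U j mj; apply: measurable_funM; first exact: mG.
  apply: measurableT_comp => //; apply: measurable_funB => //.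
  by apply: measurable_funM => //; exact: mj.
- by move=> y; rewrite mulr_ge0// expR_ge0.
Qed.

Lemma ge0_gaussian_shiftD (b : I -> bool) (s : I -> R) (G : (I -> R) -> R) :
  cylinder_measurable D G -> (forall y, 0 <= G y) ->
  (\int[P]_w (G (fun i => if i \in D then (-1) ^+ b i * J i w + s i
                          else J i w))%:E =
   \int[P]_w (G (fun i => J i w)
              * expR (\sum_(i in D) (s i * J i w - s i ^+ 2 / 2)))%:E)%E.
Proof.
move=> mG G0; have eD : {subset enum D <= D} by move=> i; rewrite mem_enum.
transitivity (\int[P]_w (G (shift b s (enum D) (fun i => J i w)))%:E)%E.
  apply: eq_integral => w _; congr (G _)%:E; apply/funext => i.
  by rewrite /shift mem_enum.
rewrite ge0_gaussian_shift_seq ?enum_uniq//.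
by apply: eq_integral => w _; rewrite big_enum.
Qed.

(** The density is nonnegative, so it commutes with positive and negative parts, and each part is
    transported separately. *)
Lemma gaussian_shiftD (b : I -> bool) (s : I -> R) (G : (I -> R) -> R) :
  cylinder_measurable D G ->
  (\int[P]_w (G (fun i => if i \in D then (-1) ^+ b i * J i w + s i
                          else J i w))%:E =
   \int[P]_w (G (fun i => J i w)
              * expR (\sum_(i in D) (s i * J i w - s i ^+ 2 / 2)))%:E)%E.
Proof.
move=> mG; rewrite integralE [RHS]integralE.
have mpos : cylinder_measurable D (fun y => Num.max (G y) 0).
  by move=> d' U j mj; apply: measurable_maxr => //; exact: mG.
have mneg : cylinder_measurable D (fun y => Num.max (- G y) 0).
  move=> d' U j mj; apply: measurable_maxr => //.
  by apply: measurableT_comp => //; exact: mG.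
congr (_ - _)%E.
- transitivity (\int[P]_w (Num.max (G (fun i => if i \in D
      then (-1) ^+ b i * J i w + s i else J i w)) 0)%:E)%E.
    by apply: eq_integral => w _; rewrite !funeposE EFin_max.
  rewrite (ge0_gaussian_shiftD b s mpos); last first.
    by move=> y; rewrite le_max lexx orbT.
  apply: eq_integral => w _; rewrite !funeposE -EFin_max.
  by rewrite maxr_pMl ?expR_ge0// mul0r.
- transitivity (\int[P]_w (Num.max (- G (fun i => if i \in D
      then (-1) ^+ b i * J i w + s i else J i w)) 0)%:E)%E.
    by apply: eq_integral => w _; rewrite !funenegE EFin_max.
  rewrite (ge0_gaussian_shiftD b s mneg); last first.
    by move=> y; rewrite le_max lexx orbT.
  apply: eq_integral => w _; rewrite !funenegE -EFinN -EFin_max.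
  by rewrite maxr_pMl ?expR_ge0// mul0r mulNr.
Qed.

End shift.

(** * Functions of exponential growth *)

Section tame.
Context {R : realType} {I : finType} (D : {set I}).

Definition l1 (y : I -> R) : R := \sum_(i in D) `|y i|.

(** Exponential growth in the l1 norm is weak enough for Gaussian integrability, yet stable under
    products, where the constants simply add. The summand 1 next to [l1 y] accommodates
    constants. *)
Definition tame (G : (I -> R) -> R) : Prop :=
  cylinder_measurable D G /\
  exists2 c : R, 0 <= c & forall y, `|G y| <= expR (c * (1 + l1 y)).

Lemma l1_ge0 (y : I -> R) : 0 <= l1 y.
Proof. by apply: sumr_ge0 => i _. Qed.

Lemma le_coord_l1 (y : I -> R) (i : I) : i \in D -> `|y i| <= l1 y.
Proof. by move=> iD; rewrite /l1 (bigD1 i)//= lerDl sumr_ge0. Qed.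

Lemma expR_ge_id (x : R) : x <= expR x.
Proof. by apply: le_trans (expR_ge1Dx x); rewrite lerDr. Qed.

Lemma tame_cst (k : R) : tame (fun=> k).
Proof.
split; first by move=> *; exact: measurable_cst.
exists `|k| => // y; apply: le_trans (expR_ge_id _) _; rewrite ler_expR.
by rewrite ler_peMr// lerDl l1_ge0.
Qed.

Lemma tame_coord (i : I) : i \in D -> tame (fun y => y i).
Proof.
move=> iD; split; first by move=> d U j mj; exact: mj.
exists 1 => // y; apply: le_trans (expR_ge_id _) _; rewrite ler_expR mul1r.
by rewrite (le_trans (le_coord_l1 _ iD))// lerDr.
Qed.

Lemma tameM (G H : (I -> R) -> R) :
  tame G -> tame H -> tame (fun y => G y * H y).
Proof.
move=> [mG [c c0 cG]] [mH [e e0 eH]]; split.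
  by move=> d U j mj; apply: measurable_funM; [exact: mG|exact: mH].
exists (c + e) => [|y]; first exact: addr_ge0.
by rewrite normrM mulrDl expRD; apply: ler_pM.
Qed.

Lemma tameD (G H : (I -> R) -> R) :
  tame G -> tame H -> tame (fun y => G y + H y).
Proof.
move=> [mG [c c0 cG]] [mH [e e0 eH]]; split.
  by move=> d U j mj; apply: measurable_funD; [exact: mG|exact: mH].
(* The extra 1 yields a factor at least 2, and [u + v <= 2 * u * v] when [u] and [v] are at least
   1. *)
exists (c + e + 1) => [|y]; first by rewrite !addr_ge0.
have l0 := l1_ge0 y.
have u0 : 0 <= c * (1 + l1 y) by rewrite mulr_ge0// addr_ge0.
have v0 : 0 <= e * (1 + l1 y) by rewrite mulr_ge0// addr_ge0.
apply: (le_trans (ler_normD _ _)); apply: (le_trans (lerD (cG y) (eH y))).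
set u := expR (c * _) in cG *; set v := expR (e * _) in eH *.
have u1 : 1 <= u by rewrite /u -[leLHS]expR0 ler_expR.
have v1 : 1 <= v by rewrite /v -[leLHS]expR0 ler_expR.
have w2 : 2 <= expR (1 * (1 + l1 y)).
  by apply: le_trans (expR_ge1Dx _); rewrite mul1r; lra.
have -> : (c + e + 1) * (1 + l1 y)
    = c * (1 + l1 y) + e * (1 + l1 y) + 1 * (1 + l1 y) by ring.
rewrite !expRD -/u -/v.
apply: (@le_trans _ _ (u * v * 2)); first nra.
by rewrite ler_pM// ?mulr_ge0 ?expR_ge0.
Qed.

Lemma tameN (G : (I -> R) -> R) : tame G -> tame (fun y => - G y).
Proof.
move=> [mG [c c0 cG]]; split.
  by move=> d U j mj; apply: measurableT_comp => //; exact: mG.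
by exists c => // y; rewrite normrN.
Qed.

Lemma tame_norm (G : (I -> R) -> R) : tame G -> tame (fun y => `|G y|).
Proof.
move=> [mG [c c0 cG]]; split.
  by move=> d U j mj; apply: measurableT_comp => //; exact: mG.
by exists c => // y; rewrite normr_id.
Qed.

Lemma tame_sum (K : finType) (A : {pred K}) (G : K -> (I -> R) -> R) :
  (forall k, k \in A -> tame (G k)) -> tame (fun y => \sum_(k in A) G k y).
Proof.
move=> tG; rewrite (_ : (fun y => _) = fun y =>
   \sum_(k <- [seq k <- index_enum K | k \in A]) G k y); last first.
  by apply/funext => y; rewrite big_filter.
have : {subset [seq k <- index_enum K | k \in A] <= A}.
  by move=> k; rewrite mem_filter => /andP[].
elim: [seq k <- index_enum K | k \in A] => [_|k s IH sA].
  by under eq_fun do rewrite big_nil; exact: tame_cst.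
under eq_fun do rewrite big_cons; apply: tameD.
  by apply: tG; apply: sA; rewrite mem_head.
by apply: IH => k' k's; apply: sA; rewrite inE k's orbT.
Qed.

Lemma tame_expR_l1 (c a : R) : tame (fun y => expR (c * (1 + a * l1 y))).
Proof.
split.
  move=> d U j mj; apply: measurableT_comp => //; apply: measurable_funM => //.
  apply: measurable_funD => //; apply: measurable_funM => //.
  rewrite /l1; under eq_fun do rewrite big_mkcond/=.
  apply: measurable_sum => i; case: (boolP (i \in D)) => // iD.
  by apply: measurableT_comp => //; exact: mj.
exists (`|c| * (1 + `|a|)) => [|y]; first by rewrite mulr_ge0// addr_ge0.
rewrite ger0_norm ?expR_ge0// ler_expR.
apply: (le_trans (ler_norm _)); rewrite normrM -mulrA ler_wpM2l//.
apply: (le_trans (ler_normD _ _)); rewrite normr1 normrM (ger0_norm (l1_ge0 y)).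
have := l1_ge0 y; have := normr_ge0 a; nra.
Qed.

Lemma tame_expR_linear (s : I -> R) :
  tame (fun y => expR (\sum_(i in D) y i * s i)).
Proof.
split.
  move=> d U j mj; apply: measurableT_comp => //.
  under eq_fun do rewrite big_mkcond/=.
  apply: measurable_sum => i; case: (boolP (i \in D)) => // iD.
  by apply: measurable_funM => //; exact: mj.
exists (\sum_(i in D) `|s i|) => [|y]; first by rewrite sumr_ge0.
rewrite ger0_norm ?expR_ge0// ler_expR.
apply: (le_trans (ler_norm _)); apply: (le_trans (ler_norm_sum _ _ _)).
rewrite mulr_suml; apply: ler_sum => i iD; rewrite normrM mulrC ler_wpM2l//.
by rewrite (le_trans (le_coord_l1 _ iD))// lerDr.
Qed.

Lemma l1_scale_le (a y : I -> R) (A : R) :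
  (forall i, i \in D -> `|a i| <= A) -> l1 (fun i => a i * y i) <= A * l1 y.
Proof.
move=> aA; rewrite /l1 mulr_sumr; apply: ler_sum => i iD.
by rewrite normrM ler_wpM2r// aA.
Qed.

Lemma tame_scale (a : I -> R) (G : (I -> R) -> R) :
  tame G -> tame (fun y => G (fun i => a i * y i)).
Proof.
move=> [mG [c c0 cG]]; split.
  move=> d U j mj; apply: (mG _ _ (fun i u => a i * j i u)) => i iD.
  by apply: measurable_funM => //; exact: mj.
pose A : R := \sum_(i in D) `|a i|.
have [_ [e e0 eA]] := tame_expR_l1 c A.
exists e => // y; apply: (le_trans (cG _)); apply: le_trans (eA y).
apply: le_trans (ler_norm _); rewrite ler_expR ler_wpM2l// lerD2l.
by apply: l1_scale_le => i iD; rewrite /A (bigD1 i)//= lerDl sumr_ge0.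
Qed.

Lemma tame_dominated (G g : (I -> R) -> R) : cylinder_measurable D G ->
  tame g -> (forall y, `|G y| <= g y) -> tame G.
Proof.
move=> mG [_ [c c0 cg]] Gg; split => //; exists c => // y.
by rewrite (le_trans (Gg y))// (le_trans (ler_norm _)).
Qed.

End tame.

(** * Integrability of tame functions *)

Section expectation.
Context {R : realType} {I : finType} {D : {set I}} {d : measure_display}
  {T : measurableType d} {P : probability T R} {J : I -> {RV P >-> R}}
  (iid : iid_gaussians D J).

Lemma cylinder_measurable_RV (G : (I -> R) -> R) :
  cylinder_measurable D G -> measurable_fun setT (fun w => G (fun i => J i w)).
Proof. by move=> mG; apply: mG => i _; exact: measurable_funP. Qed.

(** The shift identity for a constant function computes the Gaussian moment generating function,
    which is therefore finite. *)
Lemma integrable_expR_linear (s : I -> R) :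
  P.-integrable setT (fun w => (expR (\sum_(i in D) J i w * s i))%:E).
Proof.
have [mE _] := tame_expR_linear D s.
apply/integrableP; split.
  by apply/measurable_EFinP; exact: cylinder_measurable_RV mE.
have mC k : cylinder_measurable D (fun=> k : R) by case: (tame_cst D k).
have := ge0_gaussian_shiftD iid (fun=> false) s
  (mC (expR (\sum_(i in D) (s i ^+ 2 / 2)))) (fun=> expR_ge0 _).
under [in RHS]eq_integral do rewrite -expRD -big_split/=.
rewrite integral_cst//= [P setT]probability_setT mule1 => e.
rewrite (_ : (\int[P]_x _)%E = (expR (\sum_(i in D) (s i ^+ 2 / 2)))%:E).
  exact: ltry.
rewrite e; apply: eq_integral => w _; rewrite ger0_norm ?expR_ge0//.
by congr ((expR _)%:E); apply: eq_bigr => i _; ring.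
Qed.

(** The exponential of [c * l1 y] is at most the sum, over all sign patterns, of exponentials of
    linear forms with coefficients [c] or [- c]. *)
Lemma integrable_tame (G : (I -> R) -> R) : tame D G ->
  P.-integrable setT (fun w => (G (fun i => J i w))%:E).
Proof.
move=> [mG [c c0 cG]].
pose e (f : {ffun I -> bool}) (w : T) : R :=
  expR (\sum_(i in D) J i w * ((-1) ^+ f i * c)).
have ie : P.-integrable setT
    (fun w => (\sum_(f : {ffun I -> bool}) (expR c * e f w)%:E)%E).
  apply: integrable_sum => // f _; under eq_fun do rewrite EFinM.
  by apply: integrableZl => //; exact: integrable_expR_linear.
apply: (le_integrable _ _ _ ie) => //.
  by apply/measurable_EFinP; exact: cylinder_measurable_RV.
move=> w _; rewrite sumEFin lee_fin -mulr_sumr.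
apply: (le_trans (cG _)); apply: le_trans (ler_norm _).
rewrite mulrDr mulr1 expRD ler_wpM2l ?expR_ge0//.
(* The sign pattern of [J] at [w] attains [c * l1]; all other terms are nonnegative. *)
pose f0 := [ffun i => J i w < 0].
rewrite (bigD1 f0)//= -[leLHS]addr0 lerD//; last first.
  by apply: sumr_ge0 => f _; exact: expR_ge0.
rewrite ler_expR /l1 mulr_sumr; apply: ler_sum => i _.
rewrite /f0 ffunE; case: ltP => h; rewrite ?expr1 ?expr0.
  by rewrite ltr0_norm// mulN1r !mulrN mulrC.
by rewrite ger0_norm// mul1r mulrC.
Qed.

End expectation.

(** * Differentiation under the expectation *)

Section differentiation.
Context {R : realType} {I : finType} {D : {set I}} {d : measure_display}
  {T : measurableType d} {P : probability T R} {J : I -> {RV P >-> R}}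
  (iid : iid_gaussians D J).

Lemma integrable_dominated (h : T -> R) (g : (I -> R) -> R) :
  tame D g -> measurable_fun setT h ->
  (forall w, `|h w| <= g (fun i => J i w)) ->
  P.-integrable setT (EFin \o h).
Proof.
move=> tg mh hg; apply: le_integrable (integrable_tame iid tg) => //.
  exact/measurable_EFinP.
by move=> w _; rewrite /= lee_fin (le_trans (hg w))// ler_norm.
Qed.

(** Domination is asked only on an interval around [a], because derivatives of square roots along a
    segment are bounded only away from its ends. *)
Lemma is_derive_expectation (h dh : R -> T -> R) (a u v : R)
    (g dg : (I -> R) -> R) :
  u < a < v -> tame D g -> tame D dg ->
  (forall t, u < t < v -> measurable_fun setT (h t)) ->
  (forall t w, u < t < v -> `|h t w| <= g (fun i => J i w)) ->
  (forall t w, u < t < v -> is_derive t (1 : R) (h ^~ w) (dh t w)) ->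
  (forall t w, u < t < v -> `|dh t w| <= dg (fun i => J i w)) ->
  is_derive a (1 : R) (fun t => \int[P]_w h t w) (\int[P]_w dh a w).
Proof.
move=> auv tg tdg mh hg dhE dhdg.
have Ia : `]u, v[%classic a by rewrite /= in_itv.
have ih x : `]u, v[%classic x -> P.-integrable setT (EFin \o h x).
  rewrite /= in_itv/= => xuv; apply: (integrable_dominated tg); first exact: mh.
  by move=> w; exact: hg.
have dh1 x w : `]u, v[%classic x -> setT w -> derivable (h ^~ w) x 1.
  by rewrite /= in_itv/= => /(dhE _ w)[].
have idg := integrable_tame iid (tame_norm tdg).
have dh2 x w : `]u, v[%classic x -> setT w ->
    `|partial1of2 h x w| <= `|dg (fun i => J i w)|.
  rewrite /= in_itv/= => xuv _; rewrite partial1of2E.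
  have [_ ->] := dhE _ w xuv.
  by rewrite (le_trans (dhdg _ w xuv))// ler_norm.
apply: DeriveDef.
  exact: (derivable_under_integral measurableT Ia ih dh1 _ idg dh2).
rewrite -derive1E.
rewrite (differentiation_under_integral measurableT Ia ih dh1 _ idg dh2)//.
by apply: eq_Rintegral => w _; rewrite partial1of2E; have [_ ->] := dhE _ w auv.
Qed.

End differentiation.

(** * Calculus of partial derivatives *)

Section gradient.
Context {R : realType} {I : finType} (D : {set I}).

(** Differentiability is encoded as the chain rule along every curve differentiable in the
    coordinates of [D]. This spares [I -> R] a normed structure and is directly the form used along
    square roots of a segment. *)
Definition has_gradient (G : (I -> R) -> R) (dG : I -> (I -> R) -> R) : Prop :=
  forall (y : R -> I -> R) (dy : I -> R) (t : R),
    (forall i, i \in D -> is_derive t (1 : R) (y ^~ i) (dy i)) ->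
    is_derive t (1 : R) (fun s => G (y s)) (\sum_(i in D) dy i * dG i (y t)).

Lemma is_derive_mulr (c : R) (f : R -> R) (df t : R) :
  is_derive t (1 : R) f df -> is_derive t (1 : R) (fun s => f s * c) (df * c).
Proof.
move=> fd; rewrite (_ : (fun s => f s * c) = c \*: f).
  by apply: is_derive_eq (is_deriveZ c fd) _; rewrite mulrC.
by apply/funext => s; rewrite /= mulrC.
Qed.

Lemma is_derive_sum_in (K : finType) (A : {pred K}) (f : K -> R -> R)
    (df : K -> R) (t : R) :
  (forall k, k \in A -> is_derive t (1 : R) (f k) (df k)) ->
  is_derive t (1 : R) (fun s => \sum_(k in A) f k s) (\sum_(k in A) df k).
Proof.
move=> fd; rewrite -big_filter; under eq_fun do rewrite -big_filter.
have : {subset [seq k <- index_enum K | k \in A] <= A}.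
  by move=> k; rewrite mem_filter => /andP[].
elim: [seq k <- index_enum K | k \in A] => [_|k s IH sA].
  by rewrite big_nil; under eq_fun do rewrite big_nil; exact: is_derive_cst.
rewrite big_cons; under eq_fun do rewrite big_cons.
apply: is_deriveD; first by apply: fd; apply: sA; rewrite mem_head.
by apply: IH => k' k's; apply: sA; rewrite inE k's orbT.
Qed.

Lemma cvg_sum_in (K : finType) (A : {pred K}) (f : K -> R -> R) (g : K -> R)
    (t : R) :
  (forall k, k \in A -> f k s @[s --> t] --> g k) ->
  \sum_(k in A) f k s @[s --> t] --> \sum_(k in A) g k.
Proof.
by move=> fg; apply: (@cvg_big _ _ +%R) => //; exact: add_continuous.
Qed.

Lemma has_gradient_ext G dG dG' :
  (forall i y, i \in D -> dG i y = dG' i y) ->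
  has_gradient G dG -> has_gradient G dG'.
Proof.
move=> e hG y dy t hy; have := hG y dy t hy.
by under eq_bigr => i iD do rewrite e//.
Qed.

Lemma has_gradientD G dG H dH : has_gradient G dG -> has_gradient H dH ->
  has_gradient (fun y => G y + H y) (fun i y => dG i y + dH i y).
Proof.
move=> hG hH y dy t hy; under eq_bigr do rewrite mulrDr.
rewrite big_split/=; apply: is_deriveD; [exact: hG|exact: hH].
Qed.

Lemma has_gradientM G dG H dH : has_gradient G dG -> has_gradient H dH ->
  has_gradient (fun y => G y * H y) (fun i y => dG i y * H y + G y * dH i y).
Proof.
move=> hG hH y dy t hy.
apply: is_derive_eq.
  apply: (@is_deriveM _ _ (fun s => G (y s)) (fun s => H (y s))).
  - exact: hG.
  - exact: hH.
rewrite /GRing.scale/= !mulr_sumr -big_split/=.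
by apply: eq_bigr => i iD; ring.
Qed.

Lemma has_gradientV G dG : (forall y, 0 < G y) -> has_gradient G dG ->
  has_gradient (fun y => (G y)^-1) (fun i y => - dG i y / G y ^+ 2).
Proof.
move=> G0 hG y dy t hy; apply: is_derive_eq.
  apply: (@is_deriveV _ (fun s => G (y s))); last exact: hG.
  by rewrite gt_eqF.
rewrite /GRing.scale/= mulr_sumr; apply: eq_bigr => i iD.
by field; rewrite gt_eqF.
Qed.

Lemma has_gradient_ln G dG : (forall y, 0 < G y) -> has_gradient G dG ->
  has_gradient (fun y => ln (G y)) (fun i y => dG i y / G y).
Proof.
move=> G0 hG y dy t hy; apply: is_derive_eq.
  apply: (@is_derive1_comp _ (@ln R) (fun s => G (y s))).
    exact: is_derive1_ln.
  exact: hG.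
by rewrite mulr_sumr; apply: eq_bigr => i iD; ring.
Qed.

Lemma has_gradient_scale (a : I -> R) G dG : has_gradient G dG ->
  has_gradient (fun y => G (fun i => a i * y i))
    (fun i y => a i * dG i (fun j => a j * y j)).
Proof.
move=> hG y dy t hy; apply: is_derive_eq.
  apply: (hG (fun s i => a i * y s i) (fun i => a i * dy i)) => i iD.
  apply: (@is_deriveZ _ _ _ (y ^~ i) (a i)).
  exact: hy.
by apply: eq_bigr => i iD; ring.
Qed.

Lemma has_gradient_cst (c : R) : has_gradient (fun=> c) (fun _ _ => 0).
Proof.
move=> y dy t _; rewrite big1 => [|i _]; last by rewrite mulr0.
exact: is_derive_cst.
Qed.

Lemma has_gradientZ (c : R) (G : (I -> R) -> R) dG : has_gradient G dG ->
  has_gradient (fun y => c * G y) (fun i y => c * dG i y).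
Proof.
move=> hG; apply: has_gradient_ext (has_gradientM (has_gradient_cst c) hG).
by move=> i y _; rewrite mul0r add0r.
Qed.

Lemma has_gradient_sum (Q : finType) (A : {pred Q})
    (G : Q -> (I -> R) -> R) dG :
  (forall q, q \in A -> has_gradient (G q) (dG q)) ->
  has_gradient (fun y => \sum_(q in A) G q y)
    (fun i y => \sum_(q in A) dG q i y).
Proof.
move=> hG y dy t hy; under eq_bigr do rewrite mulr_sumr.
by rewrite exchange_big/=; apply: is_derive_sum_in => q qA; exact: hG.
Qed.

End gradient.

(** * Gaussian integration by parts *)

Section heat.
Context {R : realType} {I : finType} {D : {set I}} {d : measure_display}
  {T : measurableType d} {P : probability T R} {J : I -> {RV P >-> R}}
  (iid : iid_gaussians D J).

Lemma Rintegral_sum_tame (K : finType) (A : {pred K})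
    (G : K -> (I -> R) -> R) :
  (forall k, k \in A -> tame D (G k)) ->
  \int[P]_w (\sum_(k in A) G k (fun i => J i w)) =
  \sum_(k in A) \int[P]_w G k (fun i => J i w).
Proof.
(* Extension by 0 makes every summand over the whole type [K] integrable. *)
move=> tG; pose G' k y := if k \in A then G k y else 0.
have iG' k : P.-integrable setT (fun w => (G' k (fun i => J i w))%:E).
  rewrite /G'; case: (boolP (k \in A)) => kA.
    exact: (integrable_tame iid (tG k kA)).
  exact: integrable0.
transitivity (fine (\int[P]_w \sum_k (G' k (fun i => J i w))%:E)).
  by rewrite /Rintegral; congr fine; apply: eq_integral => w _;
    rewrite big_mkcond -sumEFin.
rewrite integral_sum// -sum_fine; last first.
  by move=> k _; exact: integrable_fin_num (iG' k).
rewrite [RHS]big_mkcond; apply: eq_bigr => k _.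
by rewrite /G'; case: (k \in A) => //; rewrite integral0.
Qed.

Lemma RintegralZl_tame (k : R) (G : (I -> R) -> R) : tame D G ->
  \int[P]_w (k * G (fun i => J i w)) = k * \int[P]_w G (fun i => J i w).
Proof. by move=> tG; rewrite RintegralZl//; exact: (integrable_tame iid). Qed.

Let is_derive_tilt (c s : R) :
  is_derive s (1 : R) (fun s => s * c - s ^+ 2 / 2) (c - s).
Proof.
rewrite (_ : (fun s => _) = (id * cst c) - (cst 2^-1 * (id * id)) :> (R -> R)).
  apply: is_derive_eq; rewrite /GRing.scale/= !fctE/=; by field.
by apply/funext => x; rewrite !fctE/= expr2; field.
Qed.

Let is_derive_expR_tilt (c s : R) :
  is_derive s (1 : R) (fun s => expR (s * c - s ^+ 2 / 2))
    (expR (s * c - s ^+ 2 / 2) * (c - s)).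
Proof.
exact: (@is_derive1_comp _ expR (fun s => s * c - s ^+ 2 / 2)
  s _ _ (is_derive_expR _) (is_derive_tilt c s)).
Qed.

(* Differentiate at [s = 0] the Cameron-Martin identity
   [E G(J + s e_i) = E [G(J) exp(s J_i - s^2/2)]]. *)
Lemma gaussian_ibp (G : (I -> R) -> R) (dG : I -> (I -> R) -> R) (i : I) :
  i \in D -> tame D G -> tame D (dG i) -> has_gradient D G dG ->
  \int[P]_w (J i w * G (fun k => J k w)) = \int[P]_w dG i (fun k => J k w).
Proof.
move=> iD tG tdG hG.
pose e (s : R) (k : I) : R := if k == i then s else 0.
(* The trivial sign [(-1) ^+ false] gives this curve the shape required by [gaussian_shiftD]. *)
pose S (s : R) (w : T) (k : I) : R :=
  if k \in D then (-1) ^+ false * J k w + e s k else J k w.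
pose h1 s w := G (S s w).
pose h2 s w := G (fun k => J k w) * expR (s * J i w - s ^+ 2 / 2).
have h12 s : \int[P]_w h1 s w = \int[P]_w h2 s w.
  rewrite /Rintegral (gaussian_shiftD iid (fun=> false) (e s) tG.1).
  congr fine; apply: eq_integral => w _; congr (_ * expR _)%:E.
  rewrite (bigD1 i)//= /e eqxx big1 ?addr0// => k /andP[_ /negbTE ->].
  by rewrite mul0r expr0n/= mul0r subr0.
have S_le s w : -1 < s < 1 -> l1 D (S s w) <= l1 D (fun k => J k w) + 1.
  move=> /andP[s1 s2].
  apply: (@le_trans _ _ (\sum_(k in D) (`|J k w| + `|e s k|))).
    apply: ler_sum => k kD; rewrite /S kD expr0 mul1r; exact: ler_normD.
  rewrite big_split/= lerD2l (bigD1 i)//= /e eqxx big1 ?addr0.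
    by rewrite ler_norml !ltW.
  by move=> k /andP[_ /negbTE ->]; rewrite normr0.
have shift_bd (H : (I -> R) -> R) : tame D H -> exists2 g, tame D g &
    forall s w, -1 < s < 1 -> `|H (S s w)| <= g (fun k => J k w).
  move=> [_ [c c0 cH]].
  (* A shift by less than 1 raises [l1] by at most 1, and [2 + l1 <= 2 * (1 + l1)]. *)
  exists (fun y => expR (2 * c * (1 + 1 * l1 D y))); first exact: tame_expR_l1.
  move=> s w s1; apply: (le_trans (cH _)); rewrite ler_expR mul1r.
  have := S_le s w s1; have := l1_ge0 D (fun k => J k w); nra.
have z11 : -1 < (0 : R) < 1 by rewrite ltrN10 ltr01.
have S0 w : S 0 w = fun k => J k w.
  by apply/funext => k; rewrite /S /e expr0 mul1r if_same addr0 if_same.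
have d1 : is_derive (0 : R) (1 : R) (fun s => \int[P]_w h1 s w)
    (\int[P]_w dG i (S 0 w)).
  have [g tg gG] := shift_bd _ tG; have [dg tdg gdG] := shift_bd _ tdG.
  apply: (is_derive_expectation iid (h := h1)
    (dh := fun s w => dG i (S s w)) z11 tg tdg).
  - move=> s s1; apply: (tG.1 _ T (fun k w => S s w k)) => k kD.
    rewrite /S kD; apply: measurable_funD => //; apply: measurable_funM => //.
  - by move=> s w s1; exact: gG.
  - move=> s w s1; apply: is_derive_eq.
      apply: (hG (fun s k => S s w k) (fun k => if k == i then 1 else 0)).
      move=> k kD; rewrite /S kD /e; case: eqP => _.
        by rewrite -[X in is_derive _ _ _ X]add0r; apply: is_deriveD.
      exact: is_derive_cst.
    rewrite (bigD1 i)//= eqxx mul1r big1 ?addr0// => k /andP[_ /negbTE ->].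
    by rewrite mul0r.
  - by move=> s w s1; exact: gdG.
have d2 : is_derive (0 : R) (1 : R) (fun s => \int[P]_w h2 s w)
    (\int[P]_w (G (fun k => J k w)
       * ((J i w - 0) * expR (0 * J i w - 0 ^+ 2 / 2)))).
  have E_le s w : -1 < s < 1 ->
      expR (s * J i w - s ^+ 2 / 2)
      <= expR (1 * (1 + 1 * l1 D (fun k => J k w))).
    move=> s1; rewrite ler_expR !mul1r.
    have Jl := le_coord_l1 (fun k => J k w : R) iD.
    apply: (@le_trans _ _ (`|s| * `|J i w|)).
      rewrite lerBlDr -normrM (le_trans (ler_norm _))// lerDl.
      by rewrite divr_ge0// sqr_ge0.
    have s1' : `|s| <= 1 by rewrite ler_norml; case/andP: s1 => *; rewrite !ltW.
    by rewrite -[leRHS]mul1r ler_pM// (le_trans Jl)// lerDr.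
  pose g y := `|G y| * expR (1 * (1 + 1 * l1 D y)).
  have tg : tame D g by apply: tameM; [exact: tame_norm|exact: tame_expR_l1].
  have tdg : tame D (fun y => (`|y i| + 1) * g y).
    apply: tameM => //; apply: tameD; last exact: tame_cst.
    by apply: tame_norm; exact: tame_coord.
  apply: (is_derive_expectation (dh := fun s w => G (fun k => J k w)
       * ((J i w - s) * expR (s * J i w - s ^+ 2 / 2))) iid z11 tg tdg).
  - move=> s s1; apply: measurable_funM.
      exact: (cylinder_measurable_RV tG.1).
    apply: measurableT_comp => //; apply: measurable_funB => //.
    by apply: measurable_funM => //.
  - move=> s w s1; rewrite /h2 normrM ler_pM// ger0_norm ?expR_ge0//.
    exact: E_le.
  - move=> s w s1; rewrite /h2/=.
    apply: (is_derive_eq (@is_deriveZ _ _ _ _ (G (fun k => J k w)) _ _ _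
      (is_derive_expR_tilt (J i w) s))).
    by rewrite /GRing.scale/= [X in _ * X]mulrC.
  - move=> s w s1; rewrite normrM normrM mulrCA; apply: ler_pM => //.
    + rewrite (le_trans (ler_normB _ _))// lerD2l ler_norml.
      by case/andP: s1 => *; rewrite !ltW.
    + rewrite ler_pM// ger0_norm ?expR_ge0//; exact: E_le.
have [_ e1] := d1; have [_ e2] := d2.
have h12E : (fun s => \int[P]_w h1 s w) = (fun s => \int[P]_w h2 s w).
  by apply/funext => s; exact: h12.
rewrite h12E in e1.
have -> : \int[P]_w dG i (fun k => J k w) = \int[P]_w dG i (S 0 w).
  by apply: eq_Rintegral => w _; rewrite S0.
rewrite -e1 e2; apply: eq_Rintegral => w _.
by rewrite subr0 mul0r expr0n/= mul0r subr0 expR0 mulr1 mulrC.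
Qed.

End heat.

(** * The heat flow along a segment of variances *)

Section heat_flow.
Context {R : realType} {I : finType} {D : {set I}} {d : measure_display}
  {T : measurableType d} {P : probability T R} {J : I -> {RV P >-> R}}
  (iid : iid_gaussians D J) (x y : I -> R)
  (x0 : forall i, i \in D -> 0 <= x i) (y0 : forall i, i \in D -> 0 <= y i).

Definition segment (x y : I -> R) (t : R) (i : I) : R :=
  t * x i + (1 - t) * y i.

Let X := segment x y.
Let a t i : R := Num.sqrt (X t i).

(** Distinct nonnegative endpoints cannot both vanish, so a moving coordinate avoids the singularity
    of the square root inside the segment. *)
Let X_gt0 (t : R) i : 0 < t < 1 -> i \in D -> x i - y i != 0 -> 0 < X t i.
Proof.
move=> /andP[t0 t1] iD xy; rewrite /X /segment.
have xi := x0 iD; have yi := y0 iD.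
have [x00|x00] := eqVneq (x i) 0.
  have : 0 < y i.
    by rewrite lt_def yi andbT; apply: contra xy => /eqP ->; rewrite x00 subrr.
  nra.
have : 0 < x i by rewrite lt_def xi x00.
nra.
Qed.

Let is_derive_X (t : R) i : is_derive t (1 : R) (X ^~ i) (x i - y i).
Proof.
rewrite (_ : X ^~ i = (fun s => (x i - y i) * s) + cst (y i)).
  by apply: is_derive_eq; rewrite /GRing.scale/= mulr1 addr0.
by apply/funext => s; rewrite /X /segment !fctE/=; ring.
Qed.

(* When [x i = y i = 0] the derivative below reads [0 / 0 = 0]. *)
Let is_derive_a (t : R) i : 0 < t < 1 -> i \in D ->
  is_derive t (1 : R) (a ^~ i) ((x i - y i) / (2 * a t i)).
Proof.
move=> t01 iD; have [xy|xy] := eqVneq (x i - y i) 0.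
  rewrite xy mul0r (_ : a ^~ i = cst (Num.sqrt (y i))).
    exact: is_derive_cst.
  apply/funext => s; rewrite /a /X /segment /=; congr Num.sqrt.
  by move/eqP : xy; rewrite subr_eq0 => /eqP ->; ring.
rewrite mulrC.
apply: (@is_derive1_comp _ Num.sqrt (X ^~ i)).
  exact: is_derive1_sqrt (X_gt0 t01 iD xy).
exact: is_derive_X.
Qed.

(** The range of [t] is a neighbourhood of [0, 1], as continuity at the endpoints requires; on it
    both weights are at most 2 in absolute value. Where [X t i] is negative, [Num.sqrt] is 0. *)
Let a_le (t : R) i : -1 <= t <= 2 -> i \in D ->
  `|a t i| <= 1 + 2 * \sum_(k in D) (x k + y k).
Proof.
move=> /andP[t1 t2] iD; have xi := x0 iD; have yi := y0 iD.
rewrite ger0_norm ?sqrtr_ge0//.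
have S_ge : x i + y i <= \sum_(k in D) (x k + y k).
  rewrite (bigD1 i)//= lerDl sumr_ge0// => k /andP[kD _].
  by rewrite addr_ge0 ?x0 ?y0.
set S := \sum_(k in D) _ in S_ge *.
have XS : X t i <= 2 * S.
  apply: (@le_trans _ _ (2 * (x i + y i))); first by rewrite /X /segment; nra.
  by rewrite ler_wpM2l.
have S0 : 0 <= S by rewrite (le_trans _ S_ge)// addr_ge0.
rewrite -(@ger0_norm _ (1 + 2 * S)) ?addr_ge0 ?mulr_ge0//.
rewrite -sqrtr_sqr ler_wsqrtr//.
nra.
Qed.

(** [X] is affine in [t], so on the interval it stays above the smaller of its two end values. The
    bound is uniform in [t]. *)
Let da_le (u t v : R) i : 0 < u -> u < t < v -> v < 1 -> i \in D ->
  `|(x i - y i) / (2 * a t i)|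
  <= `|x i - y i| / (2 * Num.sqrt (Num.min (X u i) (X v i))).
Proof.
move=> u0 /andP[ut tv] v1 iD; have [xy|xy] := eqVneq (x i - y i) 0.
  by rewrite xy !mul0r normr0 mul0r.
have u01 : 0 < u < 1 by rewrite u0 (lt_trans ut (lt_trans tv v1)).
have v01 : 0 < v < 1 by rewrite v1 (lt_trans u0 (lt_trans ut tv)).
have Xu := X_gt0 u01 iD xy; have Xv := X_gt0 v01 iD xy.
have m0 : 0 < Num.min (X u i) (X v i) by rewrite lt_min Xu.
have mX : Num.min (X u i) (X v i) <= X t i.
  rewrite ge_min; apply/orP.
  case: (lerP (y i) (x i)) => h; [left|right]; rewrite /X /segment; nra.
rewrite normrM ler_wpM2l// ger0_norm ?invr_ge0 ?mulr_ge0 ?sqrtr_ge0//.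
rewrite lef_pV2 ?posrE ?mulr_gt0 ?sqrtr_gt0// ?(lt_le_trans m0)//.
by rewrite ler_pM2l// ler_wsqrtr.
Qed.

(** The drift-free expression at the point [t] of the segment, up to a constant factor when [G] is
    [Z log Z]. The exponential prefactor is what produces the [- G] in the derivative. *)
Definition heat (G : (I -> R) -> R) (t : R) : R :=
  expR (- (\sum_(i in D) segment x y t i) / 2)
  * \int[P]_w G (fun i => Num.sqrt (segment x y t i) * J i w).

Let dominated_segment (G : (I -> R) -> R) : tame D G -> exists2 g, tame D g &
  forall t w, -1 <= t <= 2 ->
    `|G (fun i => a t i * J i w)| <= g (fun i => J i w).
Proof.
move=> [_ [c c0 cG]]; pose A := 1 + 2 * \sum_(k in D) (x k + y k).
exists (fun y => expR (c * (1 + A * l1 D y))) => [|t w t01].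
  exact: tame_expR_l1.
rewrite (le_trans (cG _))// ler_expR ler_wpM2l// lerD2l.
by apply: l1_scale_le => i iD; exact: a_le.
Qed.

(** The chain rule gives [J i] with coefficient [(x i - y i) / (2 * a t i)]; integration by parts
    trades [J i] for [a t i] times a further derivative. The coefficient left is free of [t], so the
    derivative is again a [heat] and the lemma can be iterated. *)
Lemma is_derive_heat (G : (I -> R) -> R) (dG : I -> (I -> R) -> R)
    (ddG : I -> I -> (I -> R) -> R) (t : R) :
  0 < t < 1 ->
  tame D G -> (forall i, i \in D -> tame D (dG i)) ->
  (forall i, i \in D -> tame D (ddG i i)) ->
  has_gradient D G dG -> (forall i, i \in D -> has_gradient D (dG i) (ddG i)) ->
  is_derive t (1 : R) (heat G)
    (heat (fun z => \sum_(i in D) (x i - y i) / 2 * (ddG i i z - G z)) t).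
Proof.
move=> t01 tG tdG tddG hG hdG; case/andP: (t01) => t0 t1.
(* Midpoints towards 0 and 1, keeping the interval around [t] away from both ends. *)
pose u := t / 2; pose v := (1 + t) / 2.
have tuv : u < t < v by rewrite /u /v; apply/andP; split; lra.
have u0 : 0 < u by rewrite /u; lra.
have v1 : v < 1 by rewrite /v; lra.
have uvW s : u < s < v -> 0 < s < 1.
  by move=> /andP[us sv]; rewrite (lt_trans u0 us) (lt_trans sv v1).
have uvW' s : u < s < v -> -1 <= s <= 2.
  by move=> /uvW/andP[*]; apply/andP; split; lra.
have [g tg gG] := dominated_segment tG.
have [g' tg' gG'] := dominated_segment
  (tame_sum (fun i iD => tame_norm (tdG i iD))).
pose M i := `|x i - y i| / (2 * Num.sqrt (Num.min (X u i) (X v i))).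
pose dg z := \sum_(i in D) (M i * `|z i| * g' z).
have tdg : tame D dg.
  apply: tame_sum => i iD; apply: tameM => //.
  apply: tameM; first exact: tame_cst.
  by apply: tame_norm; exact: tame_coord.
pose h s w := G (fun i => a s i * J i w).
pose dh s w := \sum_(i in D) ((x i - y i) / (2 * a s i) * J i w)
                * dG i (fun k => a s k * J k w).
have dint : is_derive t (1 : R) (fun s => \int[P]_w h s w) (\int[P]_w dh t w).
  apply: (is_derive_expectation iid (h := h) (dh := dh) tuv tg tdg).
  - move=> s _; exact: cylinder_measurable_RV (tame_scale (a s) tG).1.
  - by move=> s w suv; apply: gG; exact: uvW'.
  - move=> s w suv.
    apply: (hG (fun s i => a s i * J i w)
      (fun i => (x i - y i) / (2 * a s i) * J i w)) => i iD.
    exact: is_derive_mulr (is_derive_a (uvW s suv) iD).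
  - move=> s w suv; rewrite (le_trans (ler_norm_sum _ _ _))//.
    apply: ler_sum => i iD; rewrite normrM ler_pM//.
      by rewrite normrM ler_wpM2r// da_le.
    apply: le_trans (gG' s w (uvW' s suv)).
    apply: le_trans (ler_norm _).
    by rewrite (bigD1 i)//= lerDl sumr_ge0.
have dintE : \int[P]_w dh t w
    = \sum_(i in D) (x i - y i) / 2
                     * \int[P]_w ddG i i (fun k => a t k * J k w).
  pose F i z := (x i - y i) / (2 * a t i) * (z i * dG i (fun k => a t k * z k)).
  have tF i : i \in D -> tame D (fun z => z i * dG i (fun k => a t k * z k)).
    by move=> iD; apply: tameM; [exact: tame_coord|exact/tame_scale/tdG].
  transitivity (\int[P]_w \sum_(i in D) F i (fun k => J k w)).
    apply: eq_Rintegral => w _; apply: eq_bigr => i iD.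
    by rewrite /F mulrA.
  rewrite (Rintegral_sum_tame iid); last first.
    by move=> i iD; apply: tameM; [exact: tame_cst|exact: tF].
  apply: eq_bigr => i iD; rewrite (RintegralZl_tame iid _ (tF i iD)).
  rewrite (gaussian_ibp iid iD (tame_scale (a t) (tdG i iD)) _
    (has_gradient_scale (a t) (hdG i iD))); last first.
    by apply: tameM; [exact: tame_cst|exact/tame_scale/tddG].
  rewrite (RintegralZl_tame iid _ (tame_scale (a t) (tddG i iD))) mulrA.
  (* A fixed coordinate contributes 0 on both sides; for a moving one [a t i] is nonzero and
     cancels. *)
  congr (_ * _); have [->|xy] := eqVneq (x i - y i) 0; first by rewrite !mul0r.
  have : a t i != 0 by rewrite gt_eqF// sqrtr_gt0; exact: X_gt0.
  by move=> ?; field.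
pose e s := expR (- (\sum_(i in D) X s i) / 2).
have de : is_derive t (1 : R) e (e t * (- (\sum_(i in D) (x i - y i)) / 2)).
  have dS : is_derive t (1 : R) (fun s => \sum_(i in D) X s i)
      (\sum_(i in D) (x i - y i)).
    by apply: is_derive_sum_in => i _; exact: is_derive_X.
  apply: (@is_derive1_comp _ expR (fun s => - (\sum_(i in D) X s i) / 2)).
  by apply: is_derive_mulr; apply: is_deriveN.
apply: (is_derive_eq (is_deriveM de dint)).
rewrite /GRing.scale/= dintE.
transitivity (e t * (\sum_(i in D) (x i - y i) / 2
    * \int[P]_w ddG i i (fun k => a t k * J k w)
    - (\sum_(i in D) (x i - y i)) / 2 * \int[P]_w h t w)); first by ring.
congr (_ * _).
have tH' i : i \in D -> tame D (fun z => ddG i i (fun k => a t k * z k)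
    + - G (fun k => a t k * z k)).
  by move=> iD; apply: tameD; [exact/tame_scale/tddG|exact/tameN/tame_scale].
rewrite [RHS](_ : _ = \int[P]_w \sum_(i in D) (x i - y i) / 2 *
  (ddG i i (fun k => a t k * J k w) + - G (fun k => a t k * J k w)))//.
rewrite [RHS](Rintegral_sum_tame iid (G := fun i z => (x i - y i) / 2 *
  (ddG i i (fun k => a t k * z k) + - G (fun k => a t k * z k)))); last first.
  by move=> i iD; apply: tameM; [exact: tame_cst|exact: tH'].
rewrite !mulr_suml -sumrB.
apply: eq_bigr => i iD; rewrite (RintegralZl_tame iid _ (tH' i iD)).
rewrite (_ : \int[P]_w (ddG i i _ + - G _) =
  \int[P]_w ddG i i (fun k => a t k * J k w) - \int[P]_w h t w); last first.
  rewrite RintegralB//.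
  - exact: (integrable_tame iid (tame_scale (a t) (tddG i iD))).
  - exact: (integrable_tame iid (tame_scale (a t) tG)).
by rewrite mulrBr.
Qed.

(** Dominated convergence suffices up to the endpoints, since the square root is continuous at 0. *)
Lemma continuous_heat (G : (I -> R) -> R) (t : R) : tame D G ->
  (forall (z : R -> I -> R) t,
    (forall i, i \in D -> z s i @[s --> t] --> z t i) ->
    G (z s) @[s --> t] --> G (z t)) ->
  0 <= t <= 1 -> heat G s @[s --> t] --> heat G t.
Proof.
move=> tG cG /andP[t0 t1].
have cX i s : X s' i @[s' --> s] --> X s i.
  have [dX _] := is_derive_X s i.
  by move/derivable1_diffP : dX => /differentiable_continuous.
have [g tg gG] := dominated_segment tG.
apply: cvgM.
  apply: continuous_cvg; first exact: continuous_expR.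
  apply: cvgMl; apply: cvgN.
  by apply: (cvg_sum_in (f := fun i s => X s i)) => i _; exact: cX.
have tuv : t \in `](-1), 2[%classic.
  by rewrite inE/= in_itv/=; apply/andP; split; lra.
apply: (continuity_under_integral (f := fun s w => G (fun i => a s i * J i w))
   measurableT _ _ (integrable_tame iid tg) _ tuv).
- move=> s _; exact: (integrable_tame iid (tame_scale (a s) tG)).
- apply: aeW => w _ s _; apply: (cG (fun s i => a s i * J i w)) => i iD.
  apply: cvgMl; apply: continuous_cvg; first exact: sqrt_continuous.
  exact: cX.
- move=> s; rewrite /= in_itv/= => /andP[s1 s2]; apply: aeW => w _.
  by apply: gG; rewrite !ltW.
Qed.

End heat_flow.

(** * Convexity from the second derivative, and entrywise squares of Gram matrices *)

Lemma convex_on01 {R : realType} (f f1 f2 : R -> R) (t : R) :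
  (forall s : R, 0 < s < 1 -> is_derive s (1 : R) f (f1 s)) ->
  (forall s : R, 0 < s < 1 -> is_derive s (1 : R) f1 (f2 s)) ->
  (forall s : R, 0 < s < 1 -> 0 <= f2 s) ->
  (forall s : R, 0 <= s <= 1 -> f r @[r --> s] --> f s) ->
  0 <= t <= 1 -> f t <= t * f 1 + (1 - t) * f 0.
Proof.
move=> der1 der2 f2_ge0 cont /andP[t0 t1].
have near01 (s : R) : s \in `]0, 1[ -> \forall r \near s, 'D_1 f r = f1 r.
  move=> s01; have := near_in_itvoo s01; apply: filterS => r.
  by rewrite in_itv/= => r01; have [_ ->] := der1 r r01.
have t0' : 0 <= 1 - t by rewrite subr_ge0.
have t1' : 1 - t <= 1 by rewrite gerBl.
(* The weight belongs to the first endpoint, 0, hence [1 - t]. *)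
have := @second_derivative_convex R f 0 1 _ _ _ _ _ (Itv01 t0' t1') ler01.
rewrite !convRE/= mulr0 add0r mulr1 /unstable.onem subKr addrC; apply.
- move=> s s01; have s01' : s \in `]0, 1[ by rewrite in_itv.
  rewrite (near_eq_derive (1 : R) (near01 s s01')); have [_ ->] := der2 s s01.
  exact: f2_ge0.
- by apply: cvg_at_left_filter; apply: cont; rewrite ler01 lexx.
- by apply: cvg_at_right_filter; apply: cont; rewrite ler01 lexx.
- by move=> s; rewrite in_itv/= => /der1[].
- move=> s s01; have h := near01 s s01; rewrite in_itv/= in s01.
  apply: (@near_eq_derivable _ _ _ f1); last by have [] := der2 s s01.
  by move: h; apply: filterS => r.
Qed.

(** The entrywise square of a Gram matrix is the Gram matrix of the tensor squares: expanding over
    pairs [k], [l] leaves nonnegative weights times squares. *)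
Lemma square_gram_ge0 {R : realType} {I K : finType} (D : {set I})
    (e : K -> R) (s : K -> I -> R) (v : I -> R) :
  (forall k, 0 <= e k) ->
  0 <= \sum_(i in D) \sum_(j in D)
         v i * v j * (\sum_(k in K) e k * (s k i * s k j)) ^+ 2.
Proof.
move=> e0.
rewrite (_ : \sum_(i in D) _ = \sum_(k in K) \sum_(l in K)
    e k * e l * (\sum_(i in D) v i * (s k i * s l i)) ^+ 2).
  by apply: sumr_ge0 => k _; apply: sumr_ge0 => l _;
    apply: mulr_ge0; [exact: mulr_ge0|exact: sqr_ge0].
transitivity (\sum_(i in D) \sum_(j in D) \sum_(k in K) \sum_(l in K)
    e k * e l * (v i * (s k i * s l i) * (v j * (s k j * s l j)))).
  apply: eq_bigr => i _; apply: eq_bigr => j _.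
  rewrite expr2 mulr_suml mulr_sumr; apply: eq_bigr => k _.
  rewrite !mulr_sumr; apply: eq_bigr => l _; ring.
under eq_bigr do rewrite exchange_big/=.
rewrite exchange_big/=; apply: eq_bigr => k _.
under eq_bigr do rewrite exchange_big/=.
rewrite exchange_big/=; apply: eq_bigr => l _.
rewrite expr2 mulr_suml mulr_sumr; apply: eq_bigr => i _.
by rewrite !mulr_sumr.
Qed.

(** * Derivatives of [Z log Z] and Gibbs covariances *)

Section partition_sums.
Context {R : realType} {I K : finType} (D : {set I})
  (b : K -> I -> bool) (k0 : K).

Let sg k i : R := (-1) ^+ b k i.

(** Differentiation multiplies the weight by a sign, so this family is closed under it; [Z1], [Z2],
    [Z3] are the unnormalised Gibbs moments of the signs. *)
Definition weighted_sum (w : K -> R) (y : I -> R) : R :=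
  \sum_(k in K) w k * expR (\sum_(i in D) y i * sg k i).

Let Z := weighted_sum (fun=> 1).
Let Z1 i := weighted_sum (sg ^~ i).
Let Z2 i j := weighted_sum (fun k => sg k i * sg k j).
Let Z3 i j l := weighted_sum (fun k => sg k i * sg k j * sg k l).

Lemma has_gradient_weighted_sum (w : K -> R) :
  has_gradient D (weighted_sum w)
    (fun i => weighted_sum (fun k => w k * sg k i)).
Proof.
apply: (@has_gradient_ext _ _ _ _ (fun i y => \sum_(k in K)
  w k * (sg k i * expR (\sum_(i in D) y i * sg k i)))).
  by move=> i y _; apply: eq_bigr => k _; rewrite mulrA.
apply: has_gradient_sum => k _; apply: has_gradientZ => y dy t hy.
apply: is_derive_eq.
  apply: (is_derive1_comp (f := expR)
    (g := fun s => \sum_(i in D) y s i * sg k i)).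
  apply: (is_derive_sum_in (df := fun i => dy i * sg k i)) => i iD.
  by apply: is_derive_mulr; exact: hy.
rewrite mulr_sumr; apply: eq_bigr => i iD; ring.
Qed.

Lemma tame_weighted_sum (w : K -> R) : tame D (weighted_sum w).
Proof.
apply: tame_sum => k _; apply: tameM; first exact: tame_cst.
exact: tame_expR_linear.
Qed.

Let Z_ge (y : I -> R) : expR (\sum_(i in D) y i * sg k0 i) <= Z y.
Proof.
rewrite /Z /weighted_sum (bigD1 k0)//= mul1r lerDl; apply: sumr_ge0 => k _.
by rewrite mul1r expR_ge0.
Qed.

Let Z_gt0 y : 0 < Z y.
Proof. by apply: lt_le_trans (Z_ge y); exact: expR_gt0. Qed.

Let measurable_lnZ : cylinder_measurable D (fun y => ln (Z y)).
Proof.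
move=> d U j mj; apply: measurableT_comp; first exact: measurable_ln.
exact: (tame_weighted_sum (fun=> 1)).1.
Qed.

(** [Z] is at least its single term at [k0], whose inverse is the exponential of a linear form. *)
Let tame_Zinv : tame D (fun y => (Z y)^-1).
Proof.
apply: (tame_dominated _ (tame_expR_linear D (fun i => - sg k0 i))) => [|y].
  move=> d U j mj.
  rewrite (_ : (fun u => _) = fun u => expR (- ln (Z (j ^~ u)))).
    apply: measurableT_comp => //; apply: measurableT_comp => //.
    exact: measurable_lnZ.
  by apply/funext => u; rewrite expRN lnK ?posrE// Z_gt0.
rewrite ger0_norm; last by rewrite invr_ge0 ltW.
under eq_bigr do rewrite mulrN; rewrite sumrN expRN.
by rewrite lef_pV2 ?posrE ?expR_gt0.
Qed.

(** [ln z <= z], applied to [Z] and to its inverse, bounds the logarithm on both sides. *)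
Lemma tame_lnZ : tame D (fun y => ln (weighted_sum (fun=> 1) y)).
Proof.
apply: (tame_dominated measurable_lnZ
  (tameD (tame_weighted_sum (fun=> 1)) tame_Zinv)) => y.
have Z0 := Z_gt0 y; have Zi0 : 0 < (Z y)^-1 by rewrite invr_gt0.
have ln_le (z : R) : 0 < z -> ln z <= z.
  by move=> z0; rewrite -[leRHS](lnK z0) expR_ge_id.
rewrite ler_norml; apply/andP; split.
  rewrite lerNl -lnV ?posrE//; apply: (le_trans (ln_le _ Zi0)).
  by rewrite lerDr; exact: ltW.
by apply: (le_trans (ln_le _ Z0)); rewrite lerDl; exact: ltW.
Qed.

Definition entropy_fun (y : I -> R) : R :=
  weighted_sum (fun=> 1) y * ln (weighted_sum (fun=> 1) y).

Lemma tame_entropy_fun : tame D entropy_fun.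
Proof. by apply: tameM; [exact: tame_weighted_sum|exact: tame_lnZ]. Qed.

Let gradZ : has_gradient D Z Z1.
Proof.
apply: has_gradient_ext (has_gradient_weighted_sum _) => i y iD.
by apply: eq_bigr => k _; rewrite mul1r.
Qed.

Let gradZinv := has_gradientV Z_gt0 gradZ.

(* Discharges the side conditions of [field]. *)
Let Zneq0 y : Z y != 0. Proof. by rewrite gt_eqF. Qed.

Let sgsg k i : sg k i * sg k i = 1.
Proof. by rewrite /sg -expr2 sqrr_sign. Qed.

Let Z2ii i y : Z2 i i y = Z y.
Proof. by apply: eq_bigr => k _; rewrite /= sgsg. Qed.

Let Z3jj i j y : Z3 i j j y = Z1 i y.
Proof. by apply: eq_bigr => k _; rewrite /= -(mulrA (sg k i)) sgsg mulr1. Qed.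

Let dF i y := Z1 i y * (ln (Z y) + 1).
Let ddF i j y := Z2 i j y * (ln (Z y) + 1) + Z1 i y * (Z1 j y * (Z y)^-1).

Let grad_F : has_gradient D entropy_fun dF.
Proof.
have h := has_gradientM gradZ (has_gradient_ln Z_gt0 gradZ).
apply: has_gradient_ext h => i y iD.
by rewrite /dF; field.
Qed.

Let grad_dF i : has_gradient D (dF i) (ddF i).
Proof.
have h := has_gradientM (has_gradient_weighted_sum (sg ^~ i))
  (has_gradientD (has_gradient_ln Z_gt0 gradZ) (has_gradient_cst 1)).
by apply: has_gradient_ext h => j y jD; rewrite /ddF addr0.
Qed.

(* [H i] is [ddF i i - entropy_fun], the image of [entropy_fun] under the
   operator [d_i^2 - 1] governing the flow [heat]. *)
Let H i y := Z y + Z1 i y * Z1 i y * (Z y)^-1.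
(** Powers of the inverse are written as repeated factors [(Z y)^-1], so that tameness follows from
    the shape of the expression. *)
Let dH i j y := Z1 j y + 2 * (Z1 i y * Z2 i j y) * (Z y)^-1
  - Z1 i y * Z1 i y * Z1 j y * ((Z y)^-1 * (Z y)^-1).
Let ddH i j l y := Z2 j l y
  + (2 * (Z2 i l y * Z2 i j y + Z1 i y * Z3 i j l y) * (Z y)^-1
     + 2 * (Z1 i y * Z2 i j y) * (- Z1 l y * ((Z y)^-1 * (Z y)^-1)))
  - (((Z2 i l y * Z1 i y + Z1 i y * Z2 i l y) * Z1 j y
      + Z1 i y * Z1 i y * Z2 j l y) * ((Z y)^-1 * (Z y)^-1)
     + Z1 i y * Z1 i y * Z1 j y
       * (- 2 * Z1 l y * ((Z y)^-1 * (Z y)^-1 * (Z y)^-1))).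

Let ddF_diag i y : ddF i i y - entropy_fun y = H i y.
Proof. rewrite /ddF /entropy_fun /H Z2ii -/Z; ring. Qed.

Let grad_H i : has_gradient D (H i) (dH i).
Proof.
have gi := has_gradient_weighted_sum (sg ^~ i).
have h := has_gradientD gradZ (has_gradientM (has_gradientM gi gi) gradZinv).
apply: has_gradient_ext h => j y jD.
by rewrite /dH -/(Z1 i) -/(Z2 i j); field.
Qed.

Let grad_dH i j : has_gradient D (dH i j) (ddH i j).
Proof.
have gi l := has_gradient_weighted_sum (sg ^~ l).
have gij := has_gradient_weighted_sum (fun k => sg k i * sg k j).
have h := has_gradientD (has_gradientD (gi j)
    (has_gradientM (has_gradientZ 2 (has_gradientM (gi i) gij)) gradZinv))
  (has_gradientZ (-1) (has_gradientM
     (has_gradientM (has_gradientM (gi i) (gi i)) (gi j))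
     (has_gradientM gradZinv gradZinv))).
have -> : dH i j = (fun y => weighted_sum (sg ^~ j) y +
    2 * (weighted_sum (sg ^~ i) y * weighted_sum (fun k => sg k i * sg k j) y)
      * (Z y)^-1 +
    -1 * (weighted_sum (sg ^~ i) y * weighted_sum (sg ^~ i) y
          * weighted_sum (sg ^~ j) y
          * ((Z y)^-1 * (Z y)^-1))).
  by apply/funext => y; rewrite mulN1r.
apply: has_gradient_ext h => l y lD.
rewrite /ddH -/(Z1 i) -/(Z1 j) -/(Z2 i j) -/(Z2 i l) -/(Z2 j l) -/(Z3 i j l).
by field.
Qed.

(** Because signs square to 1, the terms [Z] and [Z1 i ^+ 2 / Z] cancel, and the three remaining
    ones form a perfect square. The base of the square is [Z] times the Gibbs covariance. *)
Let ddH_diag i j y : ddH i j j y - H i y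
  = 2 * (Z y)^-1 * (Z2 i j y - Z1 i y * Z1 j y / Z y) ^+ 2.
Proof. by rewrite /ddH /H Z2ii Z3jj; field. Qed.

(** Centring the signs at their Gibbs means exhibits the covariance as a Gram sum with Boltzmann
    weights, as [square_gram_ge0] expects. *)
Let cov_sum i j y : Z2 i j y - Z1 i y * Z1 j y / Z y =
  \sum_(k in K) expR (\sum_(l in D) y l * sg k l)
    * ((sg k i - Z1 i y / Z y) * (sg k j - Z1 j y / Z y)).
Proof.
set e := fun k => expR (\sum_(l in D) y l * sg k l).
set mi := Z1 i y / Z y; set mj := Z1 j y / Z y.
transitivity (Z2 i j y - mj * Z1 i y - mi * Z1 j y + mi * mj * Z y).
  by rewrite /mi /mj; field.
rewrite /Z /Z1 /Z2 /weighted_sum !mulr_sumr -!sumrN -!big_split/=.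
apply: eq_bigr => k _; rewrite -/(e k); ring.
Qed.

Context {d : measure_display} {T : measurableType d} {P : probability T R}
  {J : I -> {RV P >-> R}} (iid : iid_gaussians D J) (x y : I -> R)
  (x0 : forall i, i \in D -> 0 <= x i) (y0 : forall i, i \in D -> 0 <= y i).

Local Notation hx := (@heat _ _ D _ _ P J x y).

(** The coefficients of [is_derive_heat]. [G2] and [G3] are the integrands of the first and second
    derivatives of the flow of [entropy_fun]; [dG2] and [ddG2] are partial derivatives of [G2]. *)
Let v i : R := (x i - y i) / 2.
Let G2 z := \sum_(i in D) v i * H i z.
Let dG2 j z := \sum_(i in D) v i * dH i j z.
Let ddG2 j l z := \sum_(i in D) v i * ddH i j l z.
Let G3 z := \sum_(j in D) v j * (ddG2 j j z - G2 z).

Let G3_ge0 z : 0 <= G3 z.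
Proof.
rewrite (_ : G3 z = 2 * (Z z)^-1 * \sum_(i in D) \sum_(j in D)
    v i * v j * (Z2 i j z - Z1 i z * Z1 j z / Z z) ^+ 2).
  rewrite !mulr_ge0 ?invr_ge0 ?(ltW (Z_gt0 _))//.
  under eq_bigr => i _ do under eq_bigr => j _ do rewrite cov_sum.
  apply: (square_gram_ge0 D (e := fun k => expR (\sum_(l in D) z l * sg k l))
    (fun k i => sg k i - Z1 i z / Z z) v) => k.
  exact: expR_ge0.
rewrite exchange_big mulr_sumr/=; apply: eq_bigr => j _.
rewrite /G2 /ddG2 -sumrB !mulr_sumr; apply: eq_bigr => i _.
by rewrite -mulrBr ddH_diag; ring.
Qed.

Local Ltac prove_tame := repeat first [exact: tame_Zinv | exact: tame_lnZ
  | exact: tame_weighted_sum | exact: tame_cst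
  | apply: tame_sum => ? ? | apply: tameD | apply: tameM | apply: tameN].

Let der1 (t : R) : 0 < t < 1 ->
  is_derive t (1 : R) (hx entropy_fun)
    (hx G2 t).
Proof.
move=> t01.
have -> : G2 = fun z =>
    \sum_(i in D) (x i - y i) / 2 * (ddF i i z - entropy_fun z).
  by apply/funext => z; apply: eq_bigr => i _; rewrite ddF_diag.
apply: (is_derive_heat iid x0 y0 t01 tame_entropy_fun _ _ grad_F).
- by move=> i iD; rewrite /dF; prove_tame.
- by move=> i iD; rewrite /ddF; prove_tame.
- by move=> i _; exact: grad_dF.
Qed.

Let der2 (t : R) : 0 < t < 1 ->
  is_derive t (1 : R) (hx G2)
    (hx G3 t).
Proof.
move=> t01; apply: (is_derive_heat iid x0 y0 (dG := dG2) t01).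
- by rewrite /G2 /H; prove_tame.
- by move=> i iD; rewrite /dG2 /dH; prove_tame.
- by move=> i iD; rewrite /ddG2 /ddH; prove_tame.
- by apply: has_gradient_sum => i _; apply: has_gradientZ; exact: grad_H.
- move=> j _.
  by apply: has_gradient_sum => i _; apply: has_gradientZ; exact: grad_dH.
Qed.

Let cvg_entropy_fun (z : R -> I -> R) (t : R) :
  (forall i, i \in D -> z s i @[s --> t] --> z t i) ->
  entropy_fun (z s) @[s --> t] --> entropy_fun (z t).
Proof.
move=> cz.
have cZ : Z (z s) @[s --> t] --> Z (z t).
  rewrite /Z /weighted_sum.
  apply: (cvg_sum_in (f := fun k s => 1 * expR (\sum_(i in D) z s i * sg k i))).
  move=> k _.
  apply: cvgM; first exact: cvg_cst.
  apply: continuous_cvg; first exact: continuous_expR.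
  apply: (cvg_sum_in (f := fun i s => z s i * sg k i)) => i iD.
  by apply: cvgM; [exact: cz|exact: cvg_cst].
apply: cvgM => //; apply: continuous_cvg => //.
exact: continuous_ln.
Qed.

Lemma heat_entropy_convex (t : R) : 0 <= t <= 1 ->
  hx entropy_fun t <= t * hx entropy_fun 1 + (1 - t) * hx entropy_fun 0.
Proof.
apply: (convex_on01 der1 der2) => [s s01|s s01].
  rewrite /heat mulr_ge0 ?expR_ge0//.
  by apply: Rintegral_ge0 => w _; exact: G3_ge0.
exact: (continuous_heat iid x0 y0 tame_entropy_fun cvg_entropy_fun).
Qed.

End partition_sums.

(** * Gauge invariance and removal of the drift *)

Section gauge.
Context {R : realType} {I K : finType} (D : {set I})
  (b : K -> I -> bool) (k0 : K)
  (mul : K -> K -> K) (mulI : forall k, injective (mul k))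
  (b_mul : forall k l i, i \in D -> b (mul k l) i = b k i (+) b l i).

Local Notation Z := (@weighted_sum R _ _ D b (fun=> 1)).

(** Reindexing the configurations by [mul k] multiplies the sign at [i] by [(-1) ^+ b k i]. *)
Lemma partition_gauge (k : K) (z z' : I -> R) :
  (forall i, i \in D -> z' i = (-1) ^+ b k i * z i) -> Z z' = Z z.
Proof.
move=> zz'; rewrite /weighted_sum [RHS](reindex_inj (mulI (k := k)))/=.
apply: eq_bigr => l _; congr (_ * expR _); apply: eq_bigr => i iD.
by rewrite b_mul// zz'// signr_addb; ring.
Qed.

Context {d : measure_display} {T : measurableType d} {P : probability T R}
  {J : I -> {RV P >-> R}} (iid : iid_gaussians D J) (x : I -> R)
  (x0 : forall i, i \in D -> 0 <= x i).

(* For each [k] the Cameron-Martin shift combined with the sign flip [b k] gives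
   the same value; averaging over [k] turns the density into [Z]. *)
Lemma nishimori_expectation :
  (\int[P]_w (ln (Z (fun i => Num.sqrt (x i) * J i w + x i)))%:E =
   (#|K|%:R^-1 * (expR (- (\sum_(i in D) x i) / 2)
      * \int[P]_w entropy_fun D b (fun i => Num.sqrt (x i) * J i w)))%:E)%E.
Proof.
pose a i : R := Num.sqrt (x i).
pose e0 : R := expR (- (\sum_(i in D) x i) / 2).
pose G z := ln (Z (fun i => a i * z i)).
have tG : tame D G by exact: (tame_scale a (tame_lnZ D b k0)).
(* The integrand after gauge [k]: its density is the Boltzmann weight of [k] times [e0], so summing
   over [k] gives [Z]. *)
pose Gk k z := G z * (expR (\sum_(i in D) z i * (a i * (-1) ^+ b k i)) * e0).
have tGk k : tame D (Gk k).
  apply: tameM => //; apply: tameM; last exact: tame_cst.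
  exact: tame_expR_linear.
have key k : (\int[P]_w (ln (Z (fun i => a i * J i w + x i)))%:E =
    (\int[P]_w Gk k (fun i => J i w))%:E)%E.
  rewrite /Rintegral fineK; last first.
    exact: integrable_fin_num (integrable_tame iid (tGk k)).
  (* Since [x i] is the square of [a i], flipping [a i * J i w + x i] amounts to flipping [J i w]
     and shifting it by [a i * (-1) ^+ b k i]. *)
  transitivity (\int[P]_w (G (fun i => if i \in D
      then (-1) ^+ b k i * J i w + a i * (-1) ^+ b k i else J i w))%:E)%E.
    apply: eq_integral => w _; rewrite /G; congr (ln _)%:E.
    apply/esym/(@partition_gauge k) => i iD; rewrite iD.
    rewrite -[X in _ = _ * (_ + X)](sqr_sqrtr (x0 iD)) -/(a i); ring.
  rewrite (gaussian_shiftD iid (b k) _ tG.1).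
  apply: eq_integral => w _; rewrite /Gk /e0 -expRD; congr (_ * expR _)%:E.
  rewrite -sumrN mulr_suml -big_split/=; apply: eq_bigr => i iD.
  by rewrite exprMn sqrr_sign mulr1 sqr_sqrtr ?x0//; ring.
rewrite (key k0); congr EFin.
have K0 : #|K|%:R != 0 :> R.
  by rewrite pnatr_eq0 -lt0n; apply/card_gt0P; exists k0.
apply: (mulfI K0); rewrite mulVKf//.
(* By [key] all these integrals are equal. *)
transitivity (\sum_(k in K) \int[P]_w Gk k (fun i => J i w)).
  rewrite [LHS]mulr_natl -sumr_const; apply: eq_bigr => k _.
  by apply: EFin_inj; rewrite -!key.
rewrite -(Rintegral_sum_tame iid); last by move=> k _; exact: tGk.
rewrite -(RintegralZl_tame iid _ (tame_scale a (tame_entropy_fun D b k0))).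
apply: eq_Rintegral => w _.
rewrite /Gk -mulr_sumr -mulr_suml /entropy_fun /G.
rewrite -/e0 mulrA [RHS]mulrC; congr (_ * _); rewrite mulrC.
congr (_ * _); apply: eq_bigr => k _; rewrite mul1r; congr expR.
by apply: eq_bigr => i _; ring.
Qed.

End gauge.

(** * Specialisation to Ising spins *)

Definition spin_parity {V : finType} (S : {ffun V -> bool})
    (A : {set V}) : bool :=
  \big[addb/false]_(i in A) ~~ S i.

(** [true] encodes the spin 1, so [spin_parity] counts the negative spins in [A] modulo 2, and
    products of spins become [addb]. *)
Lemma spinA_parity {R : realType} {V : finType} (S : {ffun V -> bool})
    (A : {set V}) :
  spinA S A = (-1) ^+ spin_parity S A :> R.
Proof.
rewrite /spinA /spin_parity.
rewrite (big_morph (fun c : bool => (-1) ^+ c : R) (@signr_addb R) 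
  (expr0 _ : (-1) ^+ false = 1)).
by apply: eq_bigr => i _; rewrite /spin; case: (S i).
Qed.

Theorem theorem1 (R : realType) (V : finType) (Acal : {set {set V}})
  (d : measure_display) (T : measurableType d) (P : probability T R)
  (J : {set V} -> {RV P >-> R}) :
  (forall A, A \in Acal -> A != finset.set0) ->
  mutually_independent P Acal (fun A => J A : T -> R) ->
  (forall A, A \in Acal -> standard_gaussian (J A)) ->
  forall (x y : {set V} -> R) (t : R),
    (forall A, A \in Acal -> 0 <= x A) ->
    (forall A, A \in Acal -> 0 <= y A) ->
    0 <= t <= 1 ->
    (free_energy P Acal (fun A => J A : T -> R)
        (fun A => (t * x A + (1 - t) * y A)%R)
     <= t%:E * free_energy P Acal (fun A => J A : T -> R) x
        + (1 - t)%R%:E * free_energy P Acal (fun A => J A : T -> R) y)%E.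
Proof.
move=> _ indep gauss x y t x0 y0 t01.
have iid : iid_gaussians Acal J by split.
pose S0 : {ffun V -> bool} := [ffun=> true].
(* Sitewise product of spins: it is 1, that is [true], exactly when the two spins agree. *)
pose mul (S S' : {ffun V -> bool}) := [ffun i => S i == S' i].
have mulI S : injective (mul S).
  move=> S1 S2 /ffunP e; apply/ffunP => i; have := e i; rewrite !ffunE.
  by case: (S i) (S1 i) (S2 i) => [] [] [].
have parity_mul S S' A : A \in Acal ->
    spin_parity (mul S S') A = spin_parity S A (+) spin_parity S' A.
  move=> _; rewrite /spin_parity -big_split/=; apply: eq_bigr => i _.
  by rewrite ffunE; case: (S i) (S' i) => [] [].
(* [E z] is the free energy at [z] multiplied by the number of configurations, and is a value of
   [heat]. *)
pose E (z : {set V} -> R) : R := expR (- (\sum_(A in Acal) z A) / 2)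
  * \int[P]_w entropy_fun Acal spin_parity (fun A => Num.sqrt (z A) * J A w).
pose c : R := #|{ffun V -> bool}|%:R^-1.
have free_energyE (z : {set V} -> R) : (forall A, A \in Acal -> 0 <= z A) ->
    free_energy P Acal (fun A => J A : T -> R) z = (c * E z)%:E.
  move=> z0; rewrite /c /E -(nishimori_expectation S0 mulI parity_mul iid z0).
  rewrite /free_energy unlock; apply: eq_integral => w _; congr (ln _)%:E.
  apply: eq_bigr => S _; rewrite mul1r; congr expR; apply: eq_bigr => A _.
  by rewrite spinA_parity.
have segment1 : segment x y 1 = x.
  by apply/funext => A; rewrite /segment mul1r subrr mul0r addr0.
have segment0 : segment x y 0 = y.
  by apply/funext => A; rewrite /segment mul0r subr0 mul1r add0r.
have Econv : E (fun A => t * x A + (1 - t) * y A) <= t * E x + (1 - t) * E y.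
  have := heat_entropy_convex spin_parity S0 iid x0 y0 t01.
  by rewrite /heat segment1 segment0.
rewrite !free_energyE//; last first.
  move=> A AA; case/andP: t01 => t0 t1.
  by rewrite addr_ge0// mulr_ge0 ?subr_ge0 ?x0 ?y0.
have c0 : 0 <= c by rewrite invr_ge0.
move: (E _) (E x) (E y) c c0 Econv {free_energyE} => e ex ey c c0 Econv.
rewrite -!EFinM -EFinD lee_fin mulrCA [X in _ <= _ + X]mulrCA -mulrDr.
exact: ler_wpM2l.
Qed.
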